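(* Let $I\subset\mathbb{R}$ be a nondegenerate interval, let $n\in\mathbb{N}$, let $\omega=(\omega_1,\dots,\omega_n):I\to\mathbb{R}^n$ be an $n$-dimensional positive Chebyshev system over $I$, and let $\omega_{n+1}:I\to\mathbb{R}$ be such that $\omega^*=(\omega_1,\dots,\omega_n,\omega_{n+1})$ is an $(n+1)$-dimensional positive Chebyshev system over $I$. Let $f:I\to\mathbb{R}$. Then, for every $x,y\in I$ with $x<y$, there exists $p\in[x,y]$ such that $$\big[x,\tfrac{n-1}{n}x+\tfrac1n y,\dots,\tfrac1n x+\tfrac{n-1}{n}y,y;f\big]_{\omega^*}\ge\underline{D}_{\,(\mathbf{1}_n,\omega^* )}f(p).$$
   Context: $\mathbb{N}$ is the set of positive integers. $\sigma_k(I):=\{(x_1,\dots,x_k)\in I^k\mid x_1<\dots<x_k\}$. For $\omega=(\omega_1,\dots,\omega_k):I\to\mathbb{R}^k$ and $(x_1,\dots,x_k)\in\sigma_k(I)$, $\Phi_\omega(x_1,\dots,x_k):=\det\big(\omega_i(x_j)\big)_{i,j=1}^k$. $\omega$ is a $k$-dimensional positive Chebyshev system over $I$ if $\Phi_\omega>0$ on $\sigma_k(I)$. For an $n$-dimensional $\omega$ and $f:I\to\mathbb{R}$, $(\omega,f):=(\omega_1,\dots,\omega_n,f)$, and $$[x_0,\dots,x_n;f]_{\omega^*}:=\frac{\Phi_{(\omega,f)}(x_0,\dots,x_n)}{\Phi_{\omega^*}(x_0,\dots,x_n)}\qquad\text{for }(x_0,\dots,x_n)\in\sigma_{n+1}(I).$$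 The divided difference in the claim is taken at the $n+1$ points $\tfrac{n-j}{n}x+\tfrac{j}{n}y$, $j=0,\dots,n$. $\mathbf{1}_n=(1,\dots,1)\in\mathbb{R}^n$, and for $p\in I$ the lower Dinghas type derivative (an extended real number) is $$\underline{D}_{\,(\mathbf{1}_n,\omega^* )}f(p):=\lim_{\delta\to0^+}\inf\Big\{\big[x,\tfrac{n-1}{n}x+\tfrac1n y,\dots,\tfrac1n x+\tfrac{n-1}{n}y,y;f\big]_{\omega^*}: (x,y)\in\sigma_2(I),\ x\le p\le y,\ y-x<\delta\Big\}.$$ *)

(* Defs.v *)
From HB Require Import structures.
From mathcomp Require Import all_boot all_order all_algebra.
From mathcomp Require Import all_classical all_reals all_analysis.

Set Implicit Arguments.
Unset Strict Implicit.
Unset Printing Implicit Defensive.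
Import Order.TTheory GRing.Theory Num.Theory.
Import numFieldNormedType.Exports.

Local Open Scope classical_set_scope.
Local Open Scope ring_scope.

(* Functions on an interval I are represented by total functions R -> R; only
   their values on I are ever used. A function I -> R^k is the family of its
   coordinates; coordinates and points are numbered from 0. *)

Definition sigma (R : realType) (k : nat) (I : set R) : set ('I_k -> R) :=
  [set x | (forall j, I (x j)) /\ (forall i j : 'I_k, (i < j)%N -> x i < x j)].

Definition Phi (R : realType) (k : nat) (omega : 'I_k -> R -> R)
    (x : 'I_k -> R) : R :=
  \det (\matrix_(i < k, j < k) omega i (x j)).

Definition positive_chebyshev (R : realType) (k : nat) (I : set R)
    (omega : 'I_k -> R -> R) : Prop :=
  forall x, sigma I x -> 0 < Phi omega x.

(* (omega, f) := (omega_1, ..., omega_n, f): index n (= ord_max) is sent to f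
   and every index i < n to omega i. *)
Definition adjoin (R : realType) (n : nat) (omega : 'I_n -> R -> R)
    (f : R -> R) : 'I_n.+1 -> R -> R :=
  fun i => oapp omega f (unlift ord_max i).

(* [x_0, ..., x_n; f]_(omega^* ) for omega^* = (omega, omega1), where omega1
   stands for omega_(n+1). *)
Definition divdiff (R : realType) (n : nat) (omega : 'I_n -> R -> R)
    (omega1 f : R -> R) (x : 'I_n.+1 -> R) : R :=
  Phi (adjoin omega f) x / Phi (adjoin omega omega1) x.

(* Meaningful for 0 < n only. *)
Definition equispaced (R : realType) (n : nat) (x y : R) : 'I_n.+1 -> R :=
  fun j => (n - j)%:R / n%:R * x + j%:R / n%:R * y.

Definition lower_dinghas_inf (R : realType) (n : nat) (I : set R)
    (omega : 'I_n -> R -> R) (omega1 f : R -> R) (p delta : R) : \bar R :=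
  ereal_inf [set r : \bar R | exists x y : R,
    [/\ I x, I y & x < y] /\ x <= p <= y /\ y - x < delta /\
    r = (divdiff omega omega1 f (equispaced x y))%:E].

Definition lower_dinghas (R : realType) (n : nat) (I : set R)
    (omega : 'I_n -> R -> R) (omega1 f : R -> R) (p : R) : \bar R :=
  lim (lower_dinghas_inf I omega omega1 f p delta @[delta --> 0^'+]).

(* The limit above always exists, so [lim] never takes its default value. *)
Lemma lower_dinghas_cvg (R : realType) (n : nat) (I : set R)
    (omega : 'I_n -> R -> R) (omega1 f : R -> R) (p : R) :
  cvg (lower_dinghas_inf I omega omega1 f p delta @[delta --> 0^'+]).
Proof.
apply/cvg_ex; eexists.
apply: (@nonincreasing_at_right_cvge _ _ _ (BInfty _ false)); first by [].
move=> d e _ _ de; apply: ereal_inf_le_tmp => r [x [y [xy [pxy [yxd ->]]]]].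
by exists x, y; do !split => //; exact: lt_le_trans yxd de.
Qed.

(* Main.v *)
(* Fekete's argument: if every block of n + 1 consecutive nodes of a finite grid
   has a positive (omega, g)-determinant, then so does every choice of n + 1
   nodes. Applied to g = f - c omega_(n+1), where c is the divided difference
   over [x, y], and to the grid of half the step, this yields a subinterval of
   half the length whose divided difference is at most c. Iterating, the nested
   intervals shrink to the required point p. *)
Require Import Defs.
From HB Require Import structures.
From mathcomp Require Import all_boot all_order all_algebra.
From mathcomp Require Import all_classical all_reals all_analysis.
From mathcomp Require Import zify ring lra.
Set Implicit Arguments.
Unset Strict Implicit.

Import Order.TTheory GRing.Theory Num.Theory.
Import numFieldNormedType.Exports.

Local Open Scope classical_set_scope.
Local Open Scope ring_scope.

(** * Determinants whose last row is a varying function *)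

Lemma eq_Phi (R : realType) (k : nat) (omega : 'I_k -> R -> R)
    (x y : 'I_k -> R) : x =1 y -> Phi omega x = Phi omega y.
Proof. by move=> xy; congr (\det _); apply/matrixP => i j; rewrite !mxE xy. Qed.

(** Laplace expansion along the row of [f]; the cofactors do not involve [f], so the determinant is
    linear in [f]. *)
Lemma Phi_adjoin_expand (R : realType) (n : nat) (omega : 'I_n -> R -> R)
    (f : R -> R) (x : 'I_n.+1 -> R) :
  Phi (adjoin omega f) x =
  \sum_j f (x j) * ((-1) ^+ (n + j) * Phi omega (fun i => x (lift j i))).
Proof.
rewrite /Phi (expand_det_row _ ord_max); apply: eq_bigr => j _.
rewrite /cofactor !mxE /adjoin unlift_none /=; congr (_ * (_ * \det _)).
by apply/matrixP => i k; rewrite !mxE liftK.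
Qed.

Lemma Phi_adjoin_sub (R : realType) (n : nat) (omega : 'I_n -> R -> R)
    (f g : R -> R) (c : R) (x : 'I_n.+1 -> R) :
  Phi (adjoin omega (fun u => f u - c * g u)) x =
  Phi (adjoin omega f) x - c * Phi (adjoin omega g) x.
Proof.
rewrite !Phi_adjoin_expand mulr_sumr -sumrB; apply: eq_bigr => j _.
by rewrite mulrBl -mulrA.
Qed.

Lemma Phi_adjoin_self (R : realType) (n : nat) (omega : 'I_n -> R -> R)
    (i : 'I_n) (x : 'I_n.+1 -> R) : Phi (adjoin omega (omega i)) x = 0.
Proof.
apply: (@determinant_alternate _ _ _ (lift ord_max i) ord_max).
  by rewrite eq_sym neq_lift.
by move=> j; rewrite !mxE /adjoin unlift_none liftK.
Qed.

Lemma Phi_adjoin_sub_comb (R : realType) (n : nat) (omega : 'I_n -> R -> R)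
    (f : R -> R) (c : 'I_n -> R) (x : 'I_n.+1 -> R) :
  Phi (adjoin omega (fun u => f u - \sum_i c i * omega i u)) x =
  Phi (adjoin omega f) x.
Proof.
rewrite !Phi_adjoin_expand; under eq_bigr do rewrite mulrBl.
rewrite sumrB -[RHS]subr0; congr (_ - _).
under eq_bigr do rewrite mulr_suml; rewrite exchange_big big1 // => i _.
under eq_bigr do rewrite -mulrA; rewrite -mulr_sumr.
by rewrite -Phi_adjoin_expand Phi_adjoin_self mulr0.
Qed.

(** The collocation matrix is invertible. This serves to cancel a function at n nodes by a
    combination of [omega], which leaves its adjoined determinants unchanged. *)
Lemma Phi_interpolation (R : realType) (n : nat) (omega : 'I_n -> R -> R)
    (f : R -> R) (x : 'I_n -> R) :
  Phi omega x != 0 ->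
  exists c : 'I_n -> R, forall j, f (x j) = \sum_i c i * omega i (x j).
Proof.
rewrite /Phi; set A := (\matrix_(_, _) _) => detA.
have uA : A \in unitmx by rewrite unitmxE unitfE.
pose v := (\row_j f (x j)) *m invmx A.
exists (v 0) => j.
have /matrixP/(_ 0 j) : v *m A = \row_j f (x j) by rewrite mulmxKV.
by rewrite !mxE => <-; apply: eq_bigr => i _; rewrite [A i j]mxE.
Qed.

(** * Fekete's argument on a finite grid *)

(** When [g] vanishes at the inner nodes, the two hypotheses fix its signs at the end nodes, and
    deleting an inner node leaves a sum of two positive end terms. *)
Lemma Phi_adjoin_insert (R : realType) (I : set R) (n : nat)
    (omega : 'I_n -> R -> R) (g : R -> R) (x : 'I_n.+2 -> R) (k : 'I_n.+2) :
  (0 < n)%N -> positive_chebyshev I omega -> sigma I x ->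
  0 < Phi (adjoin omega g) (fun j => x (lift ord0 j)) ->
  0 < Phi (adjoin omega g) (fun j => x (lift ord_max j)) ->
  0 < Phi (adjoin omega g) (fun j => x (lift k j)).
Proof.
case: n omega x k => // n omega x k _ homega [xI xlt] pos0 posmax.
have [->//|k0] := eqVneq k ord0.
have [->//|kmax] := eqVneq k ord_max.
have pos2 (a : 'I_n.+3) (b : 'I_n.+2) :
    0 < Phi omega (fun i => x (lift a (lift b i))).
  by apply: homega; split=> // i j ij; apply: xlt; rewrite /= /bump; lia.
(* Modulo the span of omega, g may be assumed to vanish at all inner nodes. *)
have [c gc] := @Phi_interpolation _ _ _ g _
  (lt0r_neq0 (pos2 ord0 ord_max)).
pose h u := g u - \sum_i c i * omega i u.
have h0 (j : 'I_n.+3) : (0 < j < n.+2)%N -> h (x j) = 0.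
  move=> jlt; have jn : (j.-1 < n.+1)%N by lia.
  suff -> : j = lift ord0 (lift ord_max (Ordinal jn)) by rewrite /h gc subrr.
  by apply: val_inj; rewrite /= /bump /=; lia.
move: pos0 posmax; rewrite -!(Phi_adjoin_sub_comb omega g c) -/h.
rewrite !Phi_adjoin_expand.
rewrite big_ord_recr big1 /=; last first.
  by move=> i _; rewrite h0 ?mul0r //= /bump /=; have := ltn_ord i; lia.
rewrite add0r addnn -mul2n exprM sqrrN expr1n expr1n mul1r pmulr_lgt0 // => hmax.
(* Only the first node contributes; [hmin] keeps its alternating sign as a factor, which reappears
   unchanged in the goal. *)
rewrite big_ord_recl big1 /=; last first.
  by move=> i _; rewrite h0 ?mul0r //= /bump /=; have := ltn_ord i; lia.
rewrite addr0 mulrA pmulr_lgt0 // => hmin.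
rewrite big_ord_recl big_ord_recr big1 /=; last first.
  move=> i _; rewrite h0 ?mul0r //= /bump /=.
  have := ltn_ord i; have := ltn_ord k.
  by move: k0 kmax; rewrite -!val_eqE /=; lia.
(* Deleting an inner node keeps both end nodes, so the values of [h] match those in [hmin] and
   [hmax]. *)
have -> : lift k ord0 = lift ord_max ord0.
  by apply: val_inj; move: k0; rewrite -val_eqE /= /bump /=; lia.
have -> : lift k (lift ord0 ord_max) = lift ord0 ord_max.
  apply: val_inj; move: kmax (ltn_ord k); rewrite -val_eqE /= /bump /=; lia.
rewrite add0r addr_gt0 //; first by rewrite mulrA mulr_gt0.
by rewrite mulr_gt0 // addnn -mul2n exprM sqrrN expr1n expr1n mul1r.
Qed.

(** Strong induction on the spread [s n - s 0]. Filling a gap gives n + 2 nodes; deleting either end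
    node shrinks the spread, and [Phi_adjoin_insert] then handles deletion of the inserted node.
    Without gaps the nodes are consecutive. *)
Lemma Phi_adjoin_fekete (R : realType) (I : set R) (n N : nat)
    (omega : 'I_n -> R -> R) (g : R -> R) (t : nat -> R) :
  (0 < n)%N -> positive_chebyshev I omega ->
  (forall i, (i <= N)%N -> I (t i)) -> {homo t : i j / (i < j)%N >-> i < j} ->
  (forall i, (i + n <= N)%N ->
     0 < Phi (adjoin omega g) (fun j : 'I_n.+1 => t (i + j)%N)) ->
  forall s : nat -> nat, {homo s : i j / (i < j)%N} -> (s n <= N)%N ->
  0 < Phi (adjoin omega g) (fun j : 'I_n.+1 => t (s j)).
Proof.
move=> n0 homega tI tlt pos s.
have [d] := ubnP (s n - s 0)%N; elim: d s => // d IH s sd slt sN.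
have s_step j : (s j < s j.+1)%N by exact: slt.
have [[i [ilt gap]]|nogap] :=
    pselect (exists i, (i < n)%N /\ ((s i).+1 < s i.+1)%N).
  (* [u] is [s] with the grid index [(s i).+1] inserted at position [i.+1]. *)
  pose u j :=
    if (j <= i)%N then s j else if j == i.+1 then (s i).+1 else s j.-1.
  have u0 : u 0%N = s 0%N by [].
  have un : u n.+1 = s n by rewrite /u leqNgt ltnS (ltnW ilt) eqSS gtn_eqF.
  have u_step j : (u j < u j.+1)%N.
    rewrite /u; case: (ltngtP j i) => [ji|ij|->] /=.
    - exact: s_step.
    - rewrite eqSS (gtn_eqF ij); case: (j =P i.+1) => [->//|jNi].
      by case: j ij jNi => // j _ _; exact: s_step.
    - by rewrite eqxx.
  have ult : {homo u : j k / (j < k)%N} by exact: homo_ltn ltn_trans u_step.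
  have ik : (i.+1 < n.+2)%N by lia.
  have tuI : sigma I (fun j : 'I_n.+2 => t (u j)).
    split=> [j|j k jk]; last exact/tlt/ult.
    apply: tI; apply: leq_trans sN; rewrite -un.
    by have [->//|jn] := eqVneq (j : nat) n.+1; apply/ltnW/ult;
       have := ltn_ord j; lia.
  have := @Phi_adjoin_insert _ _ _ _ g _ (Ordinal ik) n0 homega tuI.
  rewrite (@eq_Phi _ _ _ (fun j => t (u (lift (Ordinal ik) j)))
             (fun j => t (s j))); last first.
    move=> j; congr t; rewrite /u /= /bump.
    case: ltnP => ij /=; last by rewrite ij.
    by rewrite add1n leqNgt ltnS (ltnW ij) /= eqSS gtn_eqF.
  (* The first two facts make the spread drop at either end; [un0] ensures that truncated
     subtraction does not hide the drop. *)
  have u01 := u_step 0%N; have un1 := u_step n; have un0 := ult _ _ n0.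
  apply.
  - apply: (IH (fun j => u j.+1)); [lia| |by lia].
    by move=> j k jk; exact: ult.
  - rewrite (@eq_Phi _ _ _ _ (fun j => t (u j))).
      by apply: IH; [lia|exact: ult|lia].
    by move=> j; congr (t (u _)); rewrite lift_max.
have s_arith j : (j <= n)%N -> s j = (s 0 + j)%N.
  elim: j => [|j IHj] jn; first by rewrite addn0.
  rewrite addnS -IHj ?(ltnW jn) //; apply/eqP; rewrite eqn_leq s_step andbT.
  by rewrite leqNgt; apply/negP => gap; apply: nogap; exists j.
rewrite (@eq_Phi _ _ _ _ (fun j : 'I_n.+1 => t (s 0 + j)%N)).
  by apply: pos; rewrite -s_arith.
by move=> j; rewrite s_arith // -ltnS.
Qed.

(** * Halving an equispaced configuration *)

Lemma sigma_equispaced (R : realType) (I : set R) (n : nat) (x y : R) :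
  is_interval I -> (0 < n)%N -> I x -> I y -> x < y ->
  sigma I (equispaced x y : 'I_n.+1 -> R).
Proof.
move=> hI n0 Ix Iy xy.
have nR0 : 0 < n%:R :> R by rewrite ltr0n.
have eqE (j : 'I_n.+1) : equispaced x y j = x + j%:R * ((y - x) / n%:R).
  have jn : (j <= n)%N by rewrite -ltnS.
  by rewrite /equispaced natrB //; field; exact: lt0r_neq0.
have h0 : 0 < (y - x) / n%:R by rewrite divr_gt0 ?subr_gt0.
split=> [j|i j ij]; last by rewrite !eqE ltrD2l ltr_pM2r // ltr_nat.
have : 0 <= j%:R * ((y - x) / n%:R) by rewrite mulr_ge0 // ltW.
have : j%:R * ((y - x) / n%:R) <= y - x.
  by rewrite mulrA ler_pdivrMr // mulrC ler_pM2l ?subr_gt0 // ler_nat -ltnS.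
by move=> ? ?; apply: (hI x y) => //; rewrite eqE; lra.
Qed.

Lemma divdiff_halve (R : realType) (I : set R) (n : nat)
    (omega : 'I_n -> R -> R) (omega1 f : R -> R) (x y : R) :
  is_interval I -> (0 < n)%N -> positive_chebyshev I omega ->
  positive_chebyshev I (adjoin omega omega1) -> I x -> I y -> x < y ->
  exists x' y', [/\ x <= x', x' < y', y' <= y, y' - x' = (y - x) / 2 &
    divdiff omega omega1 f (equispaced x' y') <=
    divdiff omega omega1 f (equispaced x y)].
Proof.
move=> hI n0 homega homega1 Ix Iy xy.
have nR0 : (n%:R : R) != 0 by rewrite pnatr_eq0 -lt0n.
(* With this step, n + 1 consecutive grid points span half of [x, y], and the even indices up to 2n
   recover the original nodes. *)
pose h := (y - x) / (2 * n)%:R.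
have h0 : 0 < h by rewrite divr_gt0 ?subr_gt0 // ltr0n; lia.
pose t i := x + i%:R * h.
have tE i (j : 'I_n.+1) : equispaced (t i) (t (i + n)%N) j = t (i + j)%N.
  have jn : (j <= n)%N by rewrite -ltnS.
  rewrite /equispaced /t natrB // !natrD; field; exact: nR0.
have t2E (j : 'I_n.+1) : equispaced x y j = t (2 * j)%N.
  have jn : (j <= n)%N by rewrite -ltnS.
  rewrite /equispaced /t /h natrB // !natrM; field; exact: nR0.
have tlt : {homo t : i j / (i < j)%N >-> i < j}.
  by move=> i j ij; rewrite /t ltrD2l ltr_pM2r // ltr_nat.
have t0 : t 0%N = x by rewrite /t mul0r addr0.
have t2n : t (2 * n)%N = y.
  by rewrite /t /h mulrC divfK ?pnatr_eq0 ?muln_eq0 -?lt0n ?n0 // addrC subrK.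
have t_le i j : (i <= j)%N -> t i <= t j.
  by rewrite leq_eqVlt => /predU1P[->//|/tlt/ltW].
have txy i : (i <= 2 * n)%N -> x <= t i <= y.
  by move=> ?; rewrite -{1}t0 -t2n !t_le.
have tI i : (i <= 2 * n)%N -> I (t i) by move=> /txy; exact: hI Ix Iy _.
set c := divdiff _ _ _ _; apply: contrapT => noxy.
pose g u := f u - c * omega1 u.
have Phi_g z : sigma I z ->
    Phi (adjoin omega g) z =
    (divdiff omega omega1 f z - c) * Phi (adjoin omega omega1) z.
  move=> /homega1/lt0r_neq0 pos.
  by rewrite Phi_adjoin_sub mulrBl /divdiff divfK.
have sxy : sigma I (equispaced x y : 'I_n.+1 -> R) by exact: sigma_equispaced.
(* At the even indices the determinant of [g] is zero by the choice of [c], which contradicts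
   positivity. *)
suff /(_ (fun j => 2 * j)%N) : forall s : nat -> nat,
    {homo s : i j / (i < j)%N} -> (s n <= 2 * n)%N ->
    0 < Phi (adjoin omega g) (fun j : 'I_n.+1 => t (s j)).
  rewrite -(eq_Phi _ t2E) Phi_g // subrr mul0r ltxx.
  by move=> pos; have // : false by apply: pos => // i j; lia.
apply: (Phi_adjoin_fekete n0 homega tI tlt) => i iN.
rewrite -(eq_Phi _ (tE i)).
have sti : sigma I (equispaced (t i) (t (i + n)%N) : 'I_n.+1 -> R).
  by apply: sigma_equispaced => //; [apply: tI; lia|apply: tI|apply: tlt; lia].
rewrite Phi_g // mulr_gt0 ?homega1 // subr_gt0 ltNge; apply/negP => le_c.
apply: noxy; exists (t i), (t (i + n)%N); split => //.
- by have /andP[] : x <= t i <= y by apply: txy; lia.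
- by apply: tlt; lia.
- by have /andP[] := txy _ iN.
- by rewrite /t /h natrD natrM; field; exact: nR0.
Qed.

(** * Nested intervals shrinking to the required point *)

Theorem theorem13 (R : realType) (I : set R) (hI : is_interval I)
    (hI2 : exists a b : R, [/\ I a, I b & a < b])
    (n : nat) (hn : (0 < n)%N)
    (omega : 'I_n -> R -> R) (homega : positive_chebyshev I omega)
    (omega1 : R -> R) (homega1 : positive_chebyshev I (adjoin omega omega1))
    (f : R -> R) (x y : R) (hx : I x) (hy : I y) (hxy : x < y) :
  exists p : R, x <= p <= y /\
    (lower_dinghas I omega omega1 f p
       <= (divdiff omega omega1 f (equispaced x y))%:E)%E.
Proof.
set c := divdiff _ _ _ _.
pose D (u : R * R) := divdiff omega omega1 f (equispaced u.1 u.2).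
(* The constraint is a premise, so that choice yields a total [F]; pairs violating it get an
   arbitrary value. *)
pose good (u v : R * R) := [/\ x <= u.1, u.1 < u.2 & u.2 <= y] ->
  [/\ u.1 <= v.1, v.1 < v.2, v.2 <= u.2, v.2 - v.1 = (u.2 - u.1) / 2 & D v <= D u].
have /choice[F FP] : forall u, exists v, good u v.
  move=> [a b]; have [[/= xa ab yb]|nP] :=
    pselect [/\ x <= a, a < b & b <= y]; last by exists (a, b) => /nP.
  have Ia : I a by apply: (hI x y) => //; lra.
  have Ib : I b by apply: (hI x y) => //; lra.
  have [a' [b' ?]] := divdiff_halve f hI hn homega homega1 Ia Ib ab.
  by exists (a', b').
pose u k := iter k F (x, y).
have uP k : [/\ x <= (u k).1, (u k).1 < (u k).2 & (u k).2 <= y].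
  elim: k => [|k IHk]; first by split.
  by have [] := FP _ IHk; rewrite -/(u k.+1) => *; case: IHk => *; split; lra.
have uS k : [/\ (u k).1 <= (u k.+1).1, (u k.+1).2 <= (u k).2,
    (u k.+1).2 - (u k.+1).1 = ((u k).2 - (u k).1) / 2 & D (u k.+1) <= D (u k)].
  by have [] := FP _ (uP k).
have u1_le : {homo (fun k => (u k).1) : i j / (i <= j)%N >-> i <= j}.
  by apply: homo_leq => [//|? ? ? |k]; [exact: le_trans|have [] := uS k].
have u2_le : {homo (fun k => (u k).2) : i j / (i <= j)%N >-> j <= i}.
  apply: homo_leq => [//|a b e ab be|k]; first exact: le_trans be ab.
  by have [] := uS k.
have u12 i j : (u i).1 <= (u j).2.
  have [_ /ltW lt _] := uP (maxn i j).
  apply: le_trans (u1_le _ _ (leq_maxl i j)) (le_trans lt _).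
  exact: u2_le (leq_maxr i j).
have uD k : D (u k) <= c.
  by elim: k => // k; apply: le_trans; have [] := uS k.
have ulen k : (u k).2 - (u k).1 = (y - x) / 2 ^+ k.
  elim: k => [|k IHk]; first by rewrite expr0 divr1.
  by have [_ _ -> _] := uS k; rewrite IHk exprSr invfM mulrA.
(* Every left endpoint is at most every right endpoint, so this supremum lies in all the
   intervals. *)
pose p := sup (range (fun k => (u k).1)).
have up k : (u k).1 <= p <= (u k).2.
  apply/andP; split.
    apply: ub_le_sup; last by exists k.
    by exists y => _ [j _ <-]; exact: u12 j 0%N.
  by apply: ge_sup; [exists x, 0%N|move=> _ [j _ <-]; exact: u12].
exists p; split; first exact: up 0%N.
apply: lime_le; first exact: lower_dinghas_cvg.
near=> d.
have d0 : 0 < d by [].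
have [k kd] : exists k, (y - x) / 2 ^+ k < d.
  (* This [k] exceeds (y - x) / d, and 2 ^ k exceeds [k]. *)
  exists (Num.truncn ((y - x) / d)).+1.
  rewrite ltr_pdivrMr ?exprn_gt0 // mulrC -ltr_pdivrMr //.
  apply: lt_trans (truncnS_gt _) _.
  by rewrite -natrX ltr_nat ltn_expl.
(* The interval [u k] contains [p] and is shorter than [d], so its divided difference, at most [c],
   competes in the infimum. *)
apply: ge_ereal_inf; exists (D (u k))%:E; last by rewrite lee_fin.
have [xu ult uy] := uP k; exists (u k).1, (u k).2.
by rewrite ulen up; split; [split=> //; apply: (hI x y) => //; lra|].
Unshelve. all: by end_near.
Qed.
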